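(* Let $Y'$ be a multiprojective space. Fix an integer $m\ge 2$ and a point $o\in\mathbb{P}^m$. Set $W:=Y'\times\mathbb{P}^m$ and $Y:=Y'\times\{o\}$. Let $\nu:W\to\mathbb{P}^N$ be the Segre embedding of $W$ and set $X:=\nu(W)$. Let $q\in\langle\nu(Y)\rangle$. (a) For every positive integer $t\le m-1+r_X(q)$, no $B\in\mathcal{S}(X,q,t)$ is concise for $X$. (b) If $q$ is concise for $\nu(Y)$, then there is $B\in\mathcal{S}(X,q,r_X(q)+m)$ which is concise for $X$.
   Context: Everything is over an algebraically closed field $\mathbb{K}$. A multiprojective space is a product $\mathbb{P}^{n_1}\times\cdots\times\mathbb{P}^{n_k}$ with $k\ge 1$ and $n_i>0$ for all $i$. Its Segre embedding is $\nu:\mathbb{P}^{n_1}\times\cdots\times\mathbb{P}^{n_k}\to\mathbb{P}^N$, $N=(n_1+1)\cdots(n_k+1)-1$, $([v_1],\dots,[v_k])\mapsto[v_1\otimes\cdots\otimes v_k]$. $\langle\ \rangle$ denotes linear span in projective space. Let $W=\mathbb{P}^{n_1}\times\cdots\times\mathbb{P}^{n_k}$ with Segre embedding $\nu$. The Segre subvarieties of $\nu(W)$ are the sets $\nu(L_1\times\cdots\times L_k)$ with each $L_i\subseteq\mathbb{P}^{n_i}$ a non-empty linear subspace, possibly a single point. Let $X'$ be a Segre subvariety of $\nu(W)$ (possibly $\nu(W)$ itself). A finite set $S\subset X'$ is concise for $X'$ if there is no Segre subvariety $X''\subsetneq X'$ with $S\subset X''$. A point $q\in\langle X'\rangle$ is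 concise for $X'$ if there is no Segre subvariety $X''\subsetneq X'$ with $q\in\langle X''\rangle$. A finite set $A\subset\mathbb{P}^N$ irredundantly spans $q\in\mathbb{P}^N$ if $q\in\langle A\rangle$ and $q\notin\langle A'\rangle$ for every proper subset $A'\subsetneq A$. The $X$-rank $r_X(q)$ of $q\in\langle X\rangle$ is the minimal cardinality of a finite set $A\subset X$ with $q\in\langle A\rangle$. For a positive integer $t$, $\mathcal{S}(X,q,t)$ is the set of all $A\subset X$ such that $\#A=t$ and $A$ irredundantly spans $q$. *)

(* Defs.v *)
From HB Require Import structures.
From mathcomp Require Import all_boot all_order all_algebra.
From mathcomp Require Import finmap.
From mathcomp Require Import boolp classical_sets.

Set Implicit Arguments.
Unset Strict Implicit.
Unset Printing Implicit Defensive.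

Import GRing.Theory.

Local Open Scope ring_scope.
Local Open Scope classical_set_scope.

(* A point of the projective space P(V) is a line of the vector space V.      *)
Record proj (K : fieldType) (V : vectType K) : Type := Proj {
  line :> {vspace V};
  dim_line : \dim line == 1%N }.

HB.instance Definition _ (K : fieldType) (V : vectType K) :=
  [isSub for @line K V].
HB.instance Definition _ (K : fieldType) (V : vectType K) :=
  [Choice of proj V by <:].

Section ProjectiveSpan.
Variables (K : fieldType) (V : vectType K).
Implicit Types (U : {vspace V}) (X : set (proj V)) (q : proj V)
               (A B : {fset proj V}).

Lemma ppoint_subproof (v : V) (v0 : v != 0) : \dim <[v]>%VS == 1%N.
Proof. by rewrite dim_vline v0. Qed.

(* [v] *)
Definition ppoint (v : V) (v0 : v != 0) : proj V := Proj (ppoint_subproof v0).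

Lemma eq_ppoint (u v : V) (c : K) (u0 : u != 0) (v0 : v != 0) :
  u = c *: v -> ppoint u0 = ppoint v0.
Proof.
move=> uE; apply/val_inj/eqP; rewrite /= eqEdim !dim_vline u0 v0 leqnn andbT.
by apply/vlineP; exists c.
Qed.

(* The projectivization of U, non-empty if and only if U is not 0.            *)
Definition linset U : set (proj V) := [set p | (line p <= U)%VS].

Definition pspan X : set (proj V) :=
  [set q | forall U, X `<=` linset U -> linset U q].

(* A proper subset of a finite set is again finite, so A' may range over      *)
(* finite sets.                                                               *)
Definition irredundantly_spans A q : Prop :=
  pspan [set` A] q /\
  forall A', (A' `<` A)%fset -> ~ pspan [set` A'] q.

Definition spanning_card X q (t : nat) : Prop :=
  exists A, [/\ [set` A] `<=` X, #|` A| = t & pspan [set` A] q].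

(* Minimum of the set of t such that spanning_card X q t; this set is         *)
(* non-empty when q lies in pspan X (Xrank_exists below), and the value 0 is  *)
(* a dummy otherwise.                                                         *)
Definition Xrank X q : nat :=
  if pselect (exists t, `[< spanning_card X q t >]) is left h
  then ex_minn h else 0%N.

(* The set S(X, q, t).                                                        *)
Definition spanning_sets X q (t : nat) : set {fset proj V} :=
  [set A | [/\ [set` A] `<=` X, #|` A| = t & irredundantly_spans A q]].

Lemma linset0 : linset 0%VS = set0.
Proof.
apply/seteqP; split=> // p; rewrite /linset /= subv0 -dimv_eq0.
by rewrite (eqP (dim_line p)).
Qed.

Lemma Xrank_exists X q : pspan X q -> exists t, spanning_card X q t.
Proof.
pose dims d := `[< exists2 A : {fset proj V}, [set` A] `<=` X &
   \dim (\sum_(p <- enum_fset A) line p)%VS = d >].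
have exd : exists d, dims d.
  by exists (\dim (\sum_(p <- enum_fset fset0) @line K V p)%VS);
     apply/asboolP; exists fset0 => // p; rewrite /= inE.
have ubd d : dims d -> (d <= \dim {:V})%N.
  by case/asboolP=> A _ <-; rewrite dimvS ?subvf.
move=> Xq; case: (ex_maxnP exd ubd) => d /asboolP[A AX dA] dmax.
exists #|` A|, A; split=> // U AU; apply/(subv_trans (Xq _ _)); last first.
  apply/(_ : (\sum_(p <- enum_fset A) line p <= U)%VS).
  by rewrite big_seq; elim/big_rec: _ => [|p W pA WU];
     rewrite ?sub0v // subv_add WU andbT; apply: AU.
move=> p Xp; rewrite /linset /=; set S := (\sum_(_ <- _) _)%VS.
have pAX : [set` (p |` A)%fset] `<=` X.
  by move=> r /=; rewrite in_fset1U => /orP[/eqP->//|]; apply: AX.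
have SpA : (S + line p <= \sum_(r <- enum_fset (p |` A)%fset) line r)%VS.
  have le r : r \in (p |` A)%fset ->
      (line r <= \sum_(r <- enum_fset (p |` A)%fset) line r)%VS.
    by move=> rA; rewrite (big_rem r) //= addvSl.
  rewrite subv_add le ?fset1U1 // andbT /S big_seq.
  elim/big_rec: _ => [|r W rA WU]; rewrite ?sub0v // subv_add WU andbT.
  by apply/le/fset1Ur.
have le_d : (\dim (S + line p) <= \dim S)%N.
  apply: leq_trans (dimvS SpA) _; rewrite dA; apply: dmax.
  by apply/asboolP; exists (p |` A)%fset.
suff /eqP-> : S == (S + line p)%VS by rewrite addvSr.
by rewrite eqEdim addvSl.
Qed.

Lemma XrankP X q : pspan X q ->
  spanning_card X q (Xrank X q) /\
  forall t, spanning_card X q t -> (Xrank X q <= t)%N.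
Proof.
move=> /Xrank_exists[t ht]; rewrite /Xrank; case: pselect => [h|]; last first.
  by case; exists t; apply/asboolP.
case: ex_minnP => r /asboolP hr rmin.
by split=> // s hs; apply/rmin/asboolP.
Qed.

End ProjectiveSpan.

Notation "''P[' K ]^ n" := (proj 'rV[K]_n.+1)
  (at level 8, n at level 2, format "''P[' K ]^ n") : type_scope.

Section Multiprojective.
Variables (K : fieldType) (I : finType) (n : I -> nat).

(* The product of the projective spaces of dimensions n i, i in I.            *)
Definition mproj : Type := forall i, 'P[K]^(n i).

(* The tensor product of the K^(n i + 1), in coordinates with respect to the  *)
(* tensor products of the vectors of the standard bases.                      *)
Definition tensor : vectType K :=
  {ffun {dffun forall i, 'I_(n i).+1} -> K^o}.

Definition pure_tensor (v : forall i, 'rV[K]_(n i).+1) : tensor :=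
  [ffun j : {dffun forall i, 'I_(n i).+1} => \prod_i v i 0 (j i)].

Lemma pure_tensor_neq0 v : (forall i, v i != 0) -> pure_tensor v != 0.
Proof.
move=> v0; have [j jP] : exists j : {dffun forall i, 'I_(n i).+1},
    forall i, v i 0 (j i) != 0.
  have ex i : exists a, v i 0 a != 0 by apply/rV0Pn/v0.
  have [j jP] := fin_all_exists ex.
  by exists (finfun j) => i; rewrite ffunE.
apply/eqP=> /ffunP/(_ j); rewrite !ffunE => /eqP.
by apply/negP/prodf_neq0 => i _.
Qed.

Lemma segre_subproof (p : mproj) :
  pure_tensor (fun i => vpick (p i)) != 0.
Proof.
apply: pure_tensor_neq0 => i.
by rewrite vpick0 -dimv_eq0 (eqP (dim_line (p i))).
Qed.

(* vpick (p i) is a non-zero vector of the line p i; the choice of this       *)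
(* representative is irrelevant (segreE below).                               *)
Definition segre (p : mproj) : proj tensor := ppoint (segre_subproof p).

Lemma segreE v (v0 : forall i, v i != 0) :
  segre (fun i => ppoint (v0 i)) = ppoint (pure_tensor_neq0 v0).
Proof.
have ex i : exists c, vpick (ppoint (v0 i)) = c *: v i.
  by apply/vlineP/(memv_pick (ppoint (v0 i))).
have [c cE] := fin_all_exists ex.
apply: (@eq_ppoint _ _ _ _ (\prod_i c i)); apply/ffunP => j.
rewrite !ffunE /GRing.scale /= -big_split /=.
by apply: eq_bigr => i _; rewrite cE mxE.
Qed.

Definition mlin (L : forall i, {vspace 'rV[K]_(n i).+1}) : set mproj :=
  [set p | forall i, linset (L i) (p i)].

(* The Segre subvarieties of the image of the Segre embedding.                *)
Definition segre_subvariety (X : set (proj tensor)) : Prop :=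
  exists2 L : forall i, {vspace 'rV[K]_(n i).+1},
    forall i, linset (L i) !=set0 & X = segre @` mlin L.

Definition concise_set (X : set (proj tensor)) (S : {fset proj tensor}) :
    Prop :=
  [set` S] `<=` X /\
  ~ exists X', [/\ segre_subvariety X', X' `<` X & [set` S] `<=` X'].

Definition concise_point (X : set (proj tensor)) (q : proj tensor) : Prop :=
  pspan X q /\
  ~ exists X', [/\ segre_subvariety X', X' `<` X & pspan X' q].

End Multiprojective.

(* The dimensions of the factors of Y' x P^m, for Y' with factors of          *)
(* dimensions n i: the factor P^m has index None.                             *)
Definition wdim (k : nat) (n : 'I_k -> nat) (m : nat) : option 'I_k -> nat :=
  fun i => if i is Some j then n j else m.

(* Y' x {o} *)
Definition Yset (K : fieldType) (k : nat) (n : 'I_k -> nat) (m : nat)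
    (o : 'P[K]^m) : set (mproj K (wdim n m)) :=
  [set p : mproj K (wdim n m) | p None = o].

Arguments Yset {K k} n {m} o.

(* Main.v *)
Require Import Defs.
From HB Require Import structures.
From mathcomp Require Import all_boot all_order all_algebra.
From mathcomp Require Import finmap.
From mathcomp Require Import boolp classical_sets.

(* Write q = y (x) z0 with z0 spanning o. A linear form phi on K^(m+1) that   *)
(* does not vanish at z0 contracts a representation q = \sum_i y_i (x) z_i to *)
(* one of q in which only the i with phi(z_i) != 0 remain, placed over o. If  *)
(* the z_i span K^(m+1), then m of them span a hyperplane avoiding z0, and    *)
(* the phi vanishing there gives m + r_X(q) <= #B. Conversely, take a minimal *)
(* representation lying over o, write z0 as the sum of a basis of K^(m+1),    *)
(* and split one of its terms y_1 (x) z0 accordingly.                         *)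

Set Implicit Arguments.
Unset Strict Implicit.
Unset Printing Implicit Defensive.

Import GRing.Theory.

Local Open Scope ring_scope.
Local Open Scope classical_set_scope.

(** Both halves rest on one device, [pspan_contraction]: for a linear form [phi] with [phi(o) != 0],
    contracting the factor [i0] by [phi] and putting [o] back fixes [q], so any set spanning [q] can
    be moved over [o], losing the points where [phi] vanishes. For a concise set the coordinates in
    the factor [i0] span, so some [phi] kills at least [n i0] of its points; this gives
    [concise_card_ge], hence (a). For (b), [exists_concise] replaces one point of a minimal set over
    [o] by [n i0 + 1] points whose coordinates form a basis with sum [o]; contraction by the dual
    basis proves irredundancy. The lemmas hold for any finite product and any factor [i0]; the
    theorem takes [i0 = None]. *)

(** * Points, representatives and spans *)

Section ProjectivePoints.
Variables (K : fieldType) (V : vectType K).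
Implicit Types (p q : proj V) (X Y : set (proj V)).

Lemma vpick_neq0 p : vpick p != 0.
Proof. by rewrite vpick0 -dimv_eq0 (eqP (dim_line p)). Qed.

Lemma line_vpick p : line p = <[vpick p]>%VS.
Proof.
apply/esym/eqP; rewrite eqEdim -memvE memv_pick.
by rewrite dim_vline vpick_neq0 (eqP (dim_line p)).
Qed.

Lemma memv_vpick (U : {vspace V}) p : (vpick p \in U) = (line p <= U)%VS.
Proof. by rewrite memvE -line_vpick. Qed.

Lemma eq_proj p q c : vpick p = c *: vpick q -> p = q.
Proof.
move=> pq; apply/val_inj/eqP; rewrite /= eqEdim !(eqP (dim_line _)) leqnn andbT.
by rewrite {1}line_vpick pq -memvE memvZ ?memv_pick.
Qed.

Lemma pspan_sub X Y q : pspan X q -> X `<=` pspan Y -> pspan Y q.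
Proof. by move=> Xq XY U YU; apply: Xq => p /XY; apply. Qed.

Lemma sub_pspan X : X `<=` pspan X.
Proof. by move=> p Xp U; apply. Qed.

Lemma pspan_nonempty X q : pspan X q -> X !=set0.
Proof.
move=> Xq; apply/set0P/eqP => X0; have : linset 0%VS q by apply: Xq; rewrite X0.
by rewrite linset0.
Qed.

Lemma vpick_ppoint (v : V) (v0 : v != 0) : exists c, vpick (ppoint v0) = c *: v.
Proof. by apply/vlineP/(memv_pick (ppoint v0)). Qed.

Lemma ppoint_vpick (v : V) (v0 : v != 0) : exists c, v = c *: vpick (ppoint v0).
Proof. by apply/vlineP; rewrite -line_vpick; apply: memv_line. Qed.

(** Greedy choice: an entry is kept unless it would bring [v] into the span, and a rejected entry
    lies in the span of the kept ones and [v]. *)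
Lemma span_avoiding (T : eqType) (z : T -> V) (s : seq T) (v : V) : v != 0 ->
  exists s', [/\ subseq s' s, v \notin <<map z s'>>%VS &
                 (<<map z s>> <= <<map z s'>> + <[v]>)%VS].
Proof.
move=> v0; elim: s => [|b s [s' [ss' vs' le_s]]].
  by exists [::]; split=> //=; rewrite ?span_nil ?memv0 ?sub0v.
have [vb|vb] := boolP (v \in <<map z (b :: s')>>%VS); last first.
  exists (b :: s'); split; rewrite /= ?eqxx // !span_cons -addvA.
  by rewrite addvS.
exists s'; split; first exact: subseq_trans ss' (subseq_cons s b).
- by [].
rewrite /= span_cons subv_add le_s andbT -memvE.
move: vb; rewrite /= span_cons => /memv_addP[_ /vlineP[c ->] [u us' vE]].
have c0 : c != 0.
  by apply: contraNneq vs' => c0; rewrite vE c0 scale0r add0r.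
have -> : z b = - c^-1 *: u + c^-1 *: v.
  by rewrite vE scalerDr scalerK // addrCA scaleNr addNr addr0.
by rewrite memv_add ?memvZ ?memv_line.
Qed.

End ProjectivePoints.

(** * Linear forms and bases in spaces of row vectors *)

Section RowVectors.
Variables (K : fieldType) (d : nat).
Implicit Types (U : {vspace 'rV[K]_d}) (w : 'rV[K]_d).

(** The map [1 - projv U] kills [U] but not [w]; some coordinate of it is the required form. *)
Lemma separating_functional U w : w \notin U ->
  exists2 phi : 'cV[K]_d, w *m phi != 0 & forall u, u \in U -> u *m phi = 0.
Proof.
move=> wU; pose f := (\1 - projv U)%VF.
have fE u : f u = u - projv U u.
  by rewrite add_lfunE opp_lfunE id_lfunE.
have fM u : u *m lin1_mx f = f u by rewrite mul_rV_lin1.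
have /rV0Pn[j fj] : f w != 0.
  by apply: contraNneq wU; rewrite fE => /eqP; rewrite subr_eq0 => /eqP->;
     apply: memv_proj.
exists (col j (lin1_mx f)) => [|u uU]; rewrite colE mulmxA -colE fM.
  by apply: contraNneq fj => /matrixP/(_ 0 0); rewrite !mxE => ->.
by rewrite fE projv_id // subrr; apply/matrixP => a b; rewrite !mxE.
Qed.

(** Some automorphism takes the all-ones vector to [w], which is thus the sum of a basis, the rows
    of [Z]. *)
Lemma unitmx_sum_rows w : w != 0 -> exists2 Z : 'M[K]_d, Z \in unitmx &
  const_mx 1 *m Z = w.
Proof.
case: d w => [|d'] w w0; first by rewrite [w]thinmx0 eqxx in w0.
pose u : 'rV[K]_d'.+1 := const_mx 1.
have u0 : u != 0.
  by apply/rV0Pn; exists 0; rewrite mxE oner_eq0.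
pose f := delta_mx 0 0 *m w : 'M[K]_d'.+1.
have uf : u *m f = w.
  rewrite mulmxA -colE (_ : col 0 u = 1%:M) ?mul1mx //.
  by apply/matrixP => a b; rewrite !ord1 !mxE eqxx.
have [|Z Zu uZ] := @complete_unitmx _ _ _ u f.
  by rewrite uf !rank_rV u0 w0.
by exists Z; rewrite // -uf uZ.
Qed.

End RowVectors.


(** * The Segre embedding and linear maps acting on one factor *)

Section Segre.
Variables (K : fieldType) (I : finType) (n : I -> nat).
Implicit Types (p : mproj K n) (f : tensor K n).

Lemma prod_dfwith (G : forall i, 'I_(n i).+1 -> K)
    (j : {dffun forall i, 'I_(n i).+1}) i (a : 'I_(n i).+1) :
  \prod_l G l ((finfun (dfwith j a) : {dffun forall i, 'I_(n i).+1}) l) =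
  G i a * \prod_(l | l != i) G l (j l).
Proof.
rewrite (bigD1 i) //= ffunE dfwith_in; congr (_ * _).
by apply: eq_bigr => l li; rewrite ffunE dfwith_out // eq_sym.
Qed.

(** Freeze the indices outside [i] where the tensor of [p] does not vanish: as the index at [i]
    varies, a pure tensor traces a multiple of its [i]-th vector. *)
Lemma segre_inj p p' : segre p = segre p' -> forall i, p i = p' i.
Proof.
move=> eqpp' i; have [j jP] : exists j : {dffun forall i, 'I_(n i).+1},
    forall i, vpick (p i) 0 (j i) != 0.
  have ex l : exists a, vpick (p l) 0 a != 0 by apply/rV0Pn/vpick_neq0.
  have [j jP] := fin_all_exists ex.
  by exists (finfun j) => l; rewrite ffunE.
pose v (r : mproj K n) := pure_tensor (fun i => vpick (r i)).
have /vlineP[c /ffunP ppE] : v p \in <[v p']>%VS.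
  by have := congr1 (@line _ _) eqpp' => /= <-; apply: memv_line.
pose P := \prod_(l | l != i) vpick (p l) 0 (j l).
pose Q := \prod_(l | l != i) vpick (p' l) 0 (j l).
have P0 : P != 0 by apply/prodf_neq0 => l _; apply: jP.
apply: (eq_proj (c := c * Q / P)); apply/rowP => a.
have := ppE (finfun (dfwith j a)); rewrite !ffunE /GRing.scale /=.
rewrite (prod_dfwith (fun l => vpick (p l) 0)).
rewrite (prod_dfwith (fun l => vpick (p' l) 0)).
rewrite -/P -/Q => vE; rewrite mxE; apply: (mulIf P0).
by rewrite [RHS]mulrAC divfK // vE mulrA mulrAC.
Qed.

Section ModeProduct.
Variables (i0 : I) (M : 'M[K]_((n i0).+1)).

(** In coordinates, the endomorphism acting by [M] on the factor [i0] and trivially on the other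
    factors. *)
Definition mode_product_fun f : tensor K n :=
  [ffun j : {dffun forall i, 'I_(n i).+1} =>
     \sum_a (f (finfun (dfwith j a)) : K) * M a (j i0)].

Lemma mode_product_is_linear : linear mode_product_fun.
Proof.
move=> c f g; apply/ffunP => j; rewrite !ffunE scaler_sumr -big_split /=.
apply: eq_bigr => a _; rewrite !ffunE mulrDl; congr (_ + _).
by rewrite /GRing.scale /= mulrA.
Qed.

HB.instance Definition _ :=
  GRing.isLinear.Build K (tensor K n) (tensor K n) _ mode_product_fun
    mode_product_is_linear.

Definition mode_product : 'End(tensor K n) := linfun mode_product_fun.

Lemma mode_product_pure v :
  mode_product (pure_tensor v) = pure_tensor (dfwith v (v i0 *m M)).
Proof.
rewrite lfunE /=; apply/ffunP => j; rewrite !ffunE.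
rewrite [RHS](bigD1 i0) //= dfwith_in mxE mulr_suml.
apply: eq_bigr => a _; rewrite ffunE (prod_dfwith (fun i => v i 0)) mulrAC.
by congr (_ * _); apply: eq_bigr => i ii0; rewrite dfwith_out // eq_sym.
Qed.

End ModeProduct.

Lemma pure_tensor_mulmx v i0 d (u : 'rV[K]_d) (Z : 'M[K]_(d, (n i0).+1)) :
  pure_tensor (dfwith v (u *m Z)) =
  \sum_j u 0 j *: pure_tensor (dfwith v (row j Z)) :> tensor K n.
Proof.
apply/ffunP => x; rewrite !ffunE sum_ffunE (bigD1 i0) //= dfwith_in mxE.
rewrite mulr_suml.
apply: eq_bigr => j _; rewrite !ffunE /GRing.scale /= -mulrA; congr (_ * _).
rewrite [RHS](bigD1 i0) //= dfwith_in mxE; congr (_ * _).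
by apply: eq_bigr => i ii0; rewrite !dfwith_out // eq_sym.
Qed.

Lemma pure_tensor_dfwithZ v i0 (c : K) (w : 'rV_(n i0).+1) :
  pure_tensor (dfwith v (c *: w)) = c *: pure_tensor (dfwith v w).
Proof.
rewrite -mul_scalar_mx pure_tensor_mulmx big_ord1 mxE eqxx.
by congr (_ *: pure_tensor (dfwith v _)); apply/rowP => a; rewrite mxE.
Qed.

Lemma dfwith_id p i : dfwith p (p i) = p.
Proof.
by apply: functional_extensionality_dep => j; case: dfwithP.
Qed.

Lemma vpick_dfwith p i (o : 'P[K]^(n i)) :
  (fun j => vpick (dfwith p o j)) = dfwith (fun j => vpick (p j)) (vpick o).
Proof.
apply: functional_extensionality_dep => j.
by case: (eqVneq i j) => [<-|ij]; rewrite ?dfwith_in ?dfwith_out.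
Qed.

(** * Contraction onto the slice over [o] *)

Variables (i0 : I) (o : 'P[K]^(n i0)).
Let Y : set (mproj K n) := [set p | p i0 = o].

Local Notation nu := (@segre K I n).

(* Apply to q the map that replaces z by phi(z) o in the factor i0: it is     *)
(* a multiple of the identity on the span of nu(Y).                           *)
Lemma pspan_contraction (phi : 'cV[K]_(n i0).+1)
    (B D : set (proj (tensor K n))) q :
    vpick o *m phi != 0 ->
    pspan (nu @` Y) q -> B `<=` range nu -> pspan B q ->
    (forall p, B (segre p) -> vpick (p i0) *m phi != 0 ->
       D (segre (dfwith p o))) ->
  pspan D q.
Proof.
move=> phio Yq BX Bq BD U DU; pose F := mode_product (phi *m vpick o).
have FE p : F (pure_tensor (fun i => vpick (p i))) =
    (vpick (p i0) *m phi) 0 0 *: pure_tensor (fun i => vpick (dfwith p o i)).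
  rewrite mode_product_pure mulmxA [_ *m phi in LHS]mx11_scalar mul_scalar_mx.
  by rewrite pure_tensor_dfwithZ (vpick_dfwith p o).
have Fq : linset (F @^-1: U)%VS q.
  apply: Bq => b Bb; have [p _ pb] := BX b Bb; rewrite -pb.
  rewrite /linset /= -memvE -memv_preim FE.
  have [p0|p0] := eqVneq (vpick (p i0) *m phi) 0.
    by rewrite p0 mxE scale0r mem0v.
  apply: memvZ; have := DU _ (BD p _ p0); rewrite pb => /(_ Bb).
  by rewrite /linset /= -memvE.
pose c := (vpick o *m phi) 0 0.
have c0 : c != 0.
  by apply: contra_neq phio => c0; rewrite [LHS]mx11_scalar -/c c0 raddf0.
have cq : linset (lker (F - c *: \1%VF)) q.
  apply: Yq => _ [p po <-]; rewrite /linset /= -memvE.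
  rewrite memv_ker add_lfunE opp_lfunE scale_lfunE id_lfunE FE.
  have -> : dfwith p o = p by rewrite -[o](po : p i0 = o) dfwith_id.
  by rewrite (po : p i0 = o) subrr.
move: cq Fq; rewrite /linset /= -!memv_vpick -memv_preim.
rewrite memv_ker add_lfunE opp_lfunE scale_lfunE id_lfunE.
by rewrite subr_eq0 => /eqP-> /(memvZ c^-1); rewrite scalerK.
Qed.

(** A left inverse exists by injectivity; [p0] is its dummy value off the image. *)
Lemma segre_section : mproj K n ->
  exists g : proj (tensor K n) -> mproj K n, cancel nu g.
Proof.
move=> p0; have : forall b, exists p, range nu b -> nu p = b.
  move=> b; case: (pselect (range nu b)) => [[p _ <-]|nb]; first by exists p.
  by exists p0.
case/choice => g gP; exists g => p.
by apply/functional_extensionality_dep/segre_inj/gP; exists p.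
Qed.

(** The counting form of contraction: points of [S] are killed by [phi], and each remaining point of
    [B] contributes at most one point over [o]. *)
Lemma finite_contraction (phi : 'cV[K]_((n i0).+1))
    (B S : {fset proj (tensor K n)}) q :
    vpick o *m phi != 0 ->
    pspan (nu @` Y) q -> [set` B] `<=` range nu -> pspan [set` B] q ->
    (forall p, nu p \in S -> vpick (p i0) *m phi = 0) ->
  exists D, [/\ [set` D] `<=` nu @` Y, pspan [set` D] q &
                (#|` D| <= #|` (B `\` S)%fset|)%N].
Proof.
move=> phio Yq BX Bq Sphi; have [_ [p0 _ _]] := pspan_nonempty Yq.
have [g gK] := segre_section p0.
exists [fset nu (dfwith (g b) o) | b in (B `\` S)%fset]%fset; split.
- move=> _ /imfsetP[b _ ->]; exists (dfwith (g b) o) => //.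
  exact: dfwith_in.
- apply: (pspan_contraction phio Yq BX Bq) => p pB p_phi.
  apply/imfsetP; exists (nu p); rewrite ?gK //= inE pB andbT.
  by apply: contra p_phi => /Sphi->.
- exact: leq_imfset_card.
Qed.

Lemma pspan_segre_slice q : pspan (nu @` Y) q -> pspan (range nu) q.
Proof.
move=> Yq; apply: pspan_sub Yq _ => _ [p _ <-].
by apply: sub_pspan; exists p.
Qed.

(** A minimal set for [q] can be moved over [o] by contraction, without gaining points. *)
Lemma Xrank_slice q : pspan (nu @` Y) q ->
  exists A, [/\ [set` A] `<=` nu @` Y, pspan [set` A] q &
                #|` A| = Xrank (range nu) q].
Proof.
move=> Yq; have [[A [AX cA Aq]] rmin] := XrankP (pspan_segre_slice Yq).
have [|phi phio _] := @separating_functional _ _ 0%VS (vpick o).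
  by rewrite memv0 vpick_neq0.
have [|D [DY Dq]] := finite_contraction phio Yq AX Aq (S := fset0).
  by move=> p; rewrite inE.
rewrite fsetD0 cA => cD; exists D; split=> //.
apply/eqP; rewrite eqn_leq cD; apply: rmin; exists D; split=> // d /DY[p _ <-].
by exists p.
Qed.

(** * Cardinality of concise sets *)

Lemma concise_card_ge (B : {fset proj (tensor K n)}) q :
  pspan (nu @` Y) q -> pspan [set` B] q -> concise_set (range nu) B ->
  (n i0 + Xrank (range nu) q <= #|` B|)%N.
Proof.
move=> Yq Bq [BX Bconcise]; have [_ [p0 _ _]] := pspan_nonempty Yq.
have [g gK] := segre_section p0.
pose z b := vpick (g b i0); pose M := <<map z (enum_fset B)>>%VS.
(* Otherwise restricting the factor [i0] to [M] gives a proper Segre subvariety containing [B]. *)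
have Mfull : (fullv <= M)%VS.
  apply/negPn/negP => /subvPn[v _ vM]; apply: Bconcise.
  have v0 : v != 0 by apply: contraNneq vM => ->; apply: mem0v.
  have memM b : b \in B -> linset M (g b i0).
    by move=> bB; rewrite /linset /= -memv_vpick; apply/memv_span/map_f.
  have [b bB] := pspan_nonempty Bq.
  pose L := dfwith (fun i => fullv : {vspace 'rV[K]_(n i).+1}) M.
  exists (nu @` mlin L); split.
  - exists L => // i; exists (g b i); rewrite /L.
    case: (eqVneq i0 i) => [<-|ii0]; rewrite ?dfwith_in ?dfwith_out //.
      exact: memM.
    exact: subvf.
  - split=> [_ [p _ <-]|XL]; first by exists p.
    have [p pL] : (nu @` mlin L) (nu (dfwith p0 (ppoint v0))).
      by apply: XL; exists (dfwith p0 (ppoint v0)).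
    move/segre_inj/(_ i0); rewrite dfwith_in => pi0.
    have := pL i0; rewrite pi0 /L dfwith_in /linset /= => /subvP/(_ v).
    by rewrite memv_line (negPf vM) => /(_ isT).
  - move=> c cB; have [p _ pc] := BX c cB; exists p => // i; rewrite /L.
    case: (eqVneq i0 i) => [<-|ii0]; rewrite ?dfwith_in ?dfwith_out //.
      by rewrite -[p]gK pc; apply: memM.
    exact: subvf.
(* [s] lists points of [B] whose coordinates span a complement of [o]; [phi] vanishes on all of
   them, so contraction discards them. *)
have [s [sB os le_s]] := span_avoiding z (enum_fset B) (vpick_neq0 o).
have [phi phio phis] := separating_functional os.
have us : uniq s := subseq_uniq sB (fset_uniq B).
pose S := [fset b in s]%fset.
have cS : #|` S| = size s by rewrite card_fseq undup_id.
have SB : (S `<=` B)%fset.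
  by apply/fsubsetP => b; rewrite !inE => /(mem_subseq sB).
have [|D [DY Dq cD]] := finite_contraction phio Yq BX Bq (S := S).
  by move=> p; rewrite !inE => pS; apply/phis/memv_span/mapP; exists (nu p);
     rewrite // /z gK.
(* The whole space has dimension [n i0 + 1], of which [o] accounts for one. *)
have size_s : (n i0 <= size s)%N.
  have := dimvS (subv_trans Mfull le_s); rewrite dimvf /dim /= mul1n.
  move/leq_trans/(_ (dimv_add_leqif _ _)).
  rewrite dim_vline vpick_neq0 addn1 ltnS.
  by move/leq_trans; apply; rewrite (leq_trans (dim_span _)) // size_map.
have rD : (Xrank (range nu) q <= #|` D|)%N.
  apply: (XrankP (pspan_segre_slice Yq)).2.
  by exists D; split=> // d /DY[p _ <-]; exists p.
move: cD; rewrite cardfsDS // cS => cD.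
rewrite -(subnKC (fsubset_leq_card SB)) cS leq_add //.
exact: leq_trans rD cD.
Qed.

Lemma segre_mlin p L : (nu @` mlin L) (nu p) -> mlin L p.
Proof.
by case=> p' p'L /segre_inj p'p i; rewrite -p'p; apply: p'L.
Qed.

(** * Construction of a concise irredundant set *)

Lemma exists_concise q : concise_point (nu @` Y) q ->
  exists2 B, spanning_sets (range nu) q (Xrank (range nu) q + n i0)%N B &
             concise_set (range nu) B.
Proof.
case=> Yq q_concise; have [A [AY Aq cA]] := Xrank_slice Yq.
have [a1 /= a1A] := pspan_nonempty Aq; have [p1 p1o p1a1] := AY _ a1A.
have rmin D : [set` D] `<=` nu @` Y -> pspan [set` D] q -> (#|` A| <= #|` D|)%N.
  move=> DY Dq; rewrite cA; apply: (XrankP (pspan_segre_slice Yq)).2.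
  by exists D; split=> // d /DY[p _ <-]; exists p.
have [Z Zu ZE] := unitmx_sum_rows (vpick_neq0 o).
have Z0 j : row j Z != 0.
  apply/eqP => Zj; have := mulmxV Zu; move/(congr1 (row j)).
  rewrite row_mul Zj mul0mx row1 => /rowP/(_ j); rewrite !mxE !eqxx.
  by move/eqP; rewrite eq_sym oner_eq0.
pose zeta j : 'P[K]^(n i0) := ppoint (Z0 j).
(* The basis dual to the rows of [Z]; each form takes the value 1 at [vpick o], the sum of the
   rows. *)
pose phi j := col j (invmx Z).
have phio j : vpick o *m phi j != 0.
  rewrite -ZE -mulmxA /phi colE (mulmxA Z) mulmxV // mul1mx -colE.
  by apply/eqP => /matrixP/(_ 0 0); rewrite !mxE => /eqP; rewrite oner_eq0.
have phi_zeta j l : l != j -> vpick (zeta l) *m phi j = 0.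
  move=> lj; have [c ->] := vpick_ppoint (Z0 l).
  rewrite -scalemxAl -row_mul /phi colE mulmxA mulmxV // mul1mx.
  by apply/rowP => a; rewrite !mxE (negPf lj) mulr0.
pose c j := nu (dfwith p1 (zeta j)).
(* The point [a1] is split along the basis: its tensor is a combination of those of the [c j]. *)
pose B := (A `\ a1 `|` [fset c j | j : 'I_(n i0).+1])%fset.
have BP b : b \in B -> b \in (A `\ a1)%fset \/ exists j, b = c j.
  by rewrite in_fsetU => /orP[|/imfsetP[j _ ->]]; [left|right; exists j].
have cB j : c j \in B.
  by rewrite in_fsetU; apply/orP; right; apply/imfsetP; exists j.
have AB a : a \in (A `\ a1)%fset -> a \in B by rewrite in_fsetU => ->.
have BX : [set` B] `<=` range nu.
  move=> b /BP[/fsetD1P[_ /AY[p _ <-]]|[j ->]]; first by exists p.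
  by exists (dfwith p1 (zeta j)).
have Bq : pspan [set` B] q.
  apply: pspan_sub Aq _ => a aA; have [->|aa1] := eqVneq a a1; last first.
    by apply/sub_pspan/AB/fsetD1P.
  rewrite -p1a1 => U BU; rewrite /linset /= -memvE.
  have -> : (fun i => vpick (p1 i)) =
      dfwith (fun i => vpick (p1 i)) (const_mx 1 *m Z).
    by rewrite ZE -vpick_dfwith -[o](p1o : p1 i0 = o) dfwith_id.
  rewrite pure_tensor_mulmx; apply: memv_suml => j _; apply: memvZ.
  have [d ->] := ppoint_vpick (Z0 j).
  rewrite pure_tensor_dfwithZ -vpick_dfwith; apply: memvZ.
  by have := BU _ (cB j); rewrite /linset /= -memvE.
have B_concise : concise_set (range nu) B.
  split=> // -[_ [[L L0 ->] [_ XL] BL]].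
  have Lzeta j : linset (L i0) (zeta j).
    by have /segre_mlin/(_ i0) := BL _ (cB j); rewrite dfwith_in.
  (* The [zeta j] come from a basis, so nothing is cut out in the factor [i0]. *)
  have Lfull v : v \in L i0.
    rewrite -[v]mulmx1 -(mulVmx Zu) mulmxA mulmx_sum_row.
    apply: memv_suml => j _.
    apply: memvZ; have := Lzeta j.
    by rewrite /linset /= -memvE.
  have Lo : linset (line o) o by apply: subvv.
  have L'P p : p i0 = o -> (forall i, i0 != i -> linset (L i) (p i)) ->
      mlin (dfwith L (line o)) p.
    move=> po pL i; case: (eqVneq i0 i) => [<-|ii0].
      by rewrite dfwith_in po.
    by rewrite dfwith_out //; apply: pL.
  have L'P' p : mlin (dfwith L (line o)) p -> Y p.
    by move=> /(_ i0); rewrite dfwith_in => po; apply/val_inj/eqP;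
       rewrite /= eqEdim po !(eqP (dim_line _)).
  apply: XL => _ [p _ <-]; exists p => // i.
  have [<-|ii0] := eqVneq i0 i; first by apply/subvP => v _.
  (* If [L i] is proper for some other [i], then [L] cut down to [o] in the factor [i0] gives a
     Segre subvariety strictly inside the slice whose span contains [A], hence [q]. *)
  apply: contrapT => pLi; apply: q_concise.
  exists (nu @` mlin (dfwith L (line o))); split.
  - exists (dfwith L (line o)) => // l; case: (eqVneq i0 l) => [<-|li0].
      by rewrite dfwith_in; exists o.
    by rewrite dfwith_out.
  - split=> [_ [p' /L'P' p'Y <-]|YL]; first by exists p'.
    apply: pLi; have /segre_mlin/(_ i) :
      (nu @` mlin (dfwith L (line o))) (nu (dfwith p o)).
      by apply: YL; exists (dfwith p o) => //; apply: dfwith_in.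
    by rewrite !dfwith_out.
  - apply: pspan_sub Aq _ => a aA; apply: sub_pspan.
    have [->|aa1] := eqVneq a a1.
      rewrite -p1a1; exists p1 => //; apply: L'P => // l li0.
      by have /segre_mlin/(_ l) := BL _ (cB ord0); rewrite dfwith_out.
    have [r ro ra] := AY a aA; rewrite -ra; exists r => //.
    apply: L'P => // l _.
    suff /segre_mlin : (nu @` mlin L) (nu r) by apply.
    by apply/BL/AB/fsetD1P; rewrite ra.
exists B => //; split=> //.
  (* Conciseness of [B] already bounds its cardinality from below; the union bound gives the other
     inequality. *)
  apply/eqP; rewrite eqn_leq addnC concise_card_ge // andbT.
  have := etrans (esym cA) (cardfsD1 a1 A); rewrite a1A add1n => ->.
  rewrite addnS -addSn addnC.
  rewrite cardfsU (leq_trans (leq_subr _ _)) // leq_add2l.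
  by rewrite (leq_trans (leq_imfset_card _ _ _)) // -cardE card_ord.
split=> // B' B'B B'q.
have B'X : [set` B'] `<=` range nu by move=> b /(fsubsetP (fproper_sub B'B))/BX.
(* B' is not all of B, so the contraction by some phi j takes it into A minus *)
(* a point, against the minimality of A.                                      *)
have drop j a : a \in A ->
    (forall p, nu p \in B' -> vpick (p i0) *m phi j != 0 ->
       nu (dfwith p o) \in (A `\ a)%fset) -> False.
  move=> aA hB'; have AaY : [set` (A `\ a)%fset] `<=` nu @` Y.
    by move=> b /fsetD1P[_ /AY].
  have Aaq : pspan [set` (A `\ a)%fset] q.
    exact: pspan_contraction (phio j) Yq B'X B'q hB'.
  by have := rmin _ AaY Aaq; rewrite (cardfsD1 a A) aA ltnn.
have dfwith_A p : nu p \in A -> dfwith p o = p.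
  case/AY => p' p'o /segre_inj/(_ i0) p'p.
  by rewrite -[o](p'o : p' i0 = o) p'p dfwith_id.
have dfwith_c p j : nu p = c j -> dfwith p o = p1.
  move/segre_inj => pc; apply: functional_extensionality_dep => i.
  case: (eqVneq i0 i) => [<-|ii0]; first by rewrite dfwith_in.
  by rewrite dfwith_out // pc dfwith_out.
have [b bB bB'] : exists2 b, b \in B & b \notin B'.
  by move: B'B; rewrite fproperE => /andP[_ /fsubsetPn].
case/BP: (bB) => [bA|[j bj]].
(* A point [b] of [A] other than [a1] is missing: points of [A] stay fixed and every [c l] goes to
   [a1], so [b] is never reached. *)
- have [ba1 bA'] := fsetD1P _ _ _ bA; apply: (drop ord0 b bA') => p pB' _.
  have /BP[pA|[l pl]] := fsubsetP (fproper_sub B'B) _ pB'.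
    have [_ pA'] := fsetD1P _ _ _ pA; rewrite dfwith_A; last exact: pA'.
    apply/fsetD1P; split; last exact: pA'.
    by apply: contraNneq bB' => <-; exact: pB'.
  by rewrite (dfwith_c _ _ pl) p1a1; apply/fsetD1P; rewrite eq_sym; split.
(* Some [c j] is missing: [phi j] kills every other [c l], so [a1] is never reached. *)
- apply: (drop j a1 a1A) => p pB' p_phi.
  have /BP[pA|[l pl]] := fsubsetP (fproper_sub B'B) _ pB'.
    have [_ pA'] := fsetD1P _ _ _ pA; rewrite dfwith_A; first exact: pA.
    exact: pA'.
  case/eqP: p_phi; rewrite (segre_inj pl) dfwith_in; apply: phi_zeta.
  by apply: contraNneq bB' => lj; rewrite bj -lj -pl; exact: pB'.
Qed.

End Segre.

Theorem proposition3p1 (K : closedFieldType) (k : nat) (n : 'I_k -> nat)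
    (k_gt0 : (0 < k)%N) (n_gt0 : forall i, (0 < n i)%N)
    (m : nat) (m_ge2 : (2 <= m)%N) (o : 'P[K]^m)
    (q : proj (tensor K (wdim n m))) :
  (* W = Y' x P^m is the whole of mproj K (wdim n m), so range nu is nu(W) *)
  let nu := @segre K (option 'I_k) (wdim n m) in
  let X := range nu in
  let nuY := nu @` Yset n o in
  pspan nuY q ->
  (forall t : nat, (0 < t)%N -> (t <= m - 1 + Xrank X q)%N ->
     forall B, spanning_sets X q t B -> ~ concise_set X B) /\
  (concise_point nuY q ->
     exists2 B, spanning_sets X q (Xrank X q + m)%N B & concise_set X B).

Proof.
move=> nu X nuY Yq; split=> [t _ t_le B [_ cB [Bq _]] B_concise|]; last first.
  exact: exists_concise.
(* This yields [m + r <= t <= m - 1 + r] with [r] the rank of [q], absurd for positive [m]. *)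
have := concise_card_ge Yq Bq B_concise; rewrite cB => /leq_trans/(_ t_le).
by rewrite -/X leq_add2r /wdim leqNgt subn1 prednK ?leqnn // ltnW.
Qed.
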